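(* With $A_t(x,y)=x^6+tx^4y^2+tx^2y^4+y^6$ and $B_t(x,y)=x^6+tx^3y^3+y^6$, we have $N(A_3)=0$, $N(B_2)=N(B_{-2})=0$, and $N(A_{-1})=1$.
   Context: For a binary sextic $p$, $N(p)$ is the number of representations $p=f_1^3+f_2^3$ with $f_1,f_2\in\mathbb{C}[x,y]$ non-proportional quadratic forms, where two representations are counted as the same if the unordered pairs $\{f_1^3,f_2^3\}$ coincide. *)

(* Defs.v *)
From HB Require Import structures.
From mathcomp Require Import all_boot all_order all_algebra.
From mathcomp Require Import finmap complex mpoly.
From mathcomp Require Import boolp classical_sets cardinality.
From mathcomp Require Import reals constructive_ereal.

Set Implicit Arguments.
Unset Strict Implicit.
Unset Printing Implicit Defensive.

Import Order.TTheory GRing.Theory Num.Theory.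

Local Open Scope ring_scope.
Local Open Scope classical_set_scope.

Section SumsOfTwoCubes.
Variable K : fieldType.

Definition varx : {mpoly K[2]} := 'X_(0 : 'I_2).
Definition vary : {mpoly K[2]} := 'X_(1 : 'I_2).

(* The zero form is proportional to every form. *)
Definition proportional (f g : {mpoly K[2]}) : Prop :=
  (exists c : K, f = c *: g) \/ (exists c : K, g = c *: f).

(* A representation is identified with the unordered pair {f1^3, f2^3}, so that
   swapping f1 and f2, or multiplying either one by a cube root of unity, does
   not give a new representation.  Note that [_.-homog] allows f = 0, which is
   then excluded by non-proportionality. *)
Definition two_cube_reps (p : {mpoly K[2]}) : set {fset {mpoly K[2]}} :=
  [set s | exists f1 f2 : {mpoly K[2]},
     [/\ f1 \is 2.-homog, f2 \is 2.-homog, ~ proportional f1 f2,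
         p = f1 ^+ 3 + f2 ^+ 3 & s = [fset f1 ^+ 3; f2 ^+ 3]%fset]].

(* The value is an extended natural number because [fset_set] of an infinite
   set is empty: without the case split, N p = 0 would not imply that there is
   no representation. *)
Definition N (p : {mpoly K[2]}) : \bar nat :=
  if `[< finite_set (two_cube_reps p) >]
  then (#|` fset_set (two_cube_reps p)|%fset)%:E else +oo%E.

Definition A (t : K) : {mpoly K[2]} :=
  varx ^+ 6 + t *: (varx ^+ 4 * vary ^+ 2) + t *: (varx ^+ 2 * vary ^+ 4)
  + vary ^+ 6.

Definition B (t : K) : {mpoly K[2]} :=
  varx ^+ 6 + t *: (varx ^+ 3 * vary ^+ 3) + vary ^+ 6.

End SumsOfTwoCubes.

(* Main.v *)
Require Import Defs.
From mathcomp Require Import all_boot all_order all_algebra.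
From mathcomp Require Import complex mpoly.
From mathcomp Require Import reals constructive_ereal.
From mathcomp Require Import finmap boolp classical_sets cardinality ring.

(* Set y = 1.  If z is a double root of f^3 + g^3 and not a common root of the
   quadratics f and g, then f - s g = c (X - z)^2 for some s with s^3 = -1; a
   triple root is always a common root, and a common root is at least triple.
   - For A_3 = ((X - i)(X + i))^3, both roots are common, so f and g are
     proportional.
   - For B_{2} and B_{-2}, the square of a cubic with three distinct roots, the
     pencil spanned by f and g would contain three independent squares.
   - For A_{-1} = (X - 1)^2 (X + 1)^2 (X^2 + 1), the pencil contains (X - 1)^2
     and (X + 1)^2, and comparing values at 1 and -1 determines (f g)^3. *)

Set Implicit Arguments.
Unset Strict Implicit.
Unset Printing Implicit Defensive.

Import GRing.Theory Num.Theory.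

Local Open Scope ring_scope.

(** * Double and triple roots of a sum of cubes of two univariate quadratics *)

Section SumOfTwoCubes.
Variable K : fieldType.
Hypothesis nz3 : (3 : K) != 0.
Implicit Types f g h q : {poly K}.

Lemma double_root_dvd h (z : K) : h.[z] = 0 -> h^`().[z] = 0 ->
  exists q, h = q * ('X - z%:P) ^+ 2.
Proof.
move=> /rootP/factor_theorem[q ->]; rewrite derivM derivXsubC !hornerE.
rewrite subrr mulr0 add0r => /rootP/factor_theorem[r ->].
by exists r; rewrite expr2 mulrA.
Qed.

Lemma quadratic_double_root h (z : K) : (size h <= 3)%N ->
  h.[z] = 0 -> h^`().[z] = 0 -> exists c, h = c%:P * ('X - z%:P) ^+ 2.
Proof.
move=> szh h0 h'0; have [q hE] := double_root_dvd h0 h'0.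
have [q0|nz_q] := eqVneq q 0; first by exists 0; rewrite hE q0 !mul0r.
exists q`_0; rewrite -size1_polyC //.
move: szh; rewrite hE size_Mmonic ?monic_exp ?monicXsubC //.
by rewrite size_exp_XsubC !addnS addn0 /= !ltnS.
Qed.

Lemma common_root_cubes f g z : f.[z] = 0 -> g.[z] = 0 ->
  exists q, f ^+ 3 + g ^+ 3 = ('X - z%:P) ^+ 3 * q.
Proof.
move=> /rootP/factor_theorem[l ->] /rootP/factor_theorem[m ->].
by exists (l ^+ 3 + m ^+ 3); ring.
Qed.

(** Take s = f(z) / g(z). The value of f^3 + g^3 at z gives s^3 = -1. Its derivative, after
    cancelling 3 g(z)^2, gives s^2 f'(z) + g'(z) = 0, and multiplying by s turns this into f'(z) = s
    g'(z). So f - s g vanishes doubly at z and, being at most quadratic, is a multiple of (X -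
    z)^2. *)
Lemma double_root_cubes f g z q : (size f <= 3)%N -> (size g <= 3)%N ->
    f ^+ 3 + g ^+ 3 = ('X - z%:P) ^+ 2 * q -> g.[z] != 0 ->
  exists s c, s ^+ 3 = -1 /\ f = s%:P * g + c%:P * ('X - z%:P) ^+ 2.
Proof.
move=> szf szg fgE nz_gz.
have := congr1 (horner^~ z) fgE; have := congr1 (fun p => p^`().[z]) fgE.
rewrite /= derivD !deriv_exp derivM deriv_exp derivXsubC !hornerE subrr /=.
rewrite ?expr0n /= !(mul0r, mulr0, mul0rn, addr0).
set a := f.[z]; set b := g.[z]; set a' := f^`().[z]; set b' := g^`().[z].
rewrite add0r subrr mul0r => dE vE.
pose s := a / b; have aE : a = s * b by rewrite divfK.
have s3 : s ^+ 3 = -1.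
  apply: (mulIf (expf_neq0 3 nz_gz)); rewrite -exprMn -aE.
  by apply/eqP; rewrite mulN1r -subr_eq0 opprK vE.
have a'E : a' = s * b'.
  have : s ^+ 2 * a' + b' = 0.
    apply: (mulIf (mulf_neq0 nz3 (expf_neq0 2 nz_gz))).
    by rewrite mul0r -[RHS]dE aE -/b; ring.
  move/(congr1 ( *%R s)); rewrite mulr0 mulrDr mulrA -exprS s3 => E.
  by apply/esym/eqP; rewrite -subr_eq0 -E mulN1r addrC.
have [||| c cE] := @quadratic_double_root (f - s%:P * g) z.
- rewrite (leq_trans (size_polyD _ _)) // geq_max szf size_polyN.
  by rewrite mul_polyC (leq_trans (size_scale_leq _ _)).
- by rewrite !hornerE -/a -/b aE subrr.
- by rewrite derivB derivM derivC mul0r add0r !hornerE -/a' -/b' a'E subrr.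
by exists s, c; split=> //; rewrite -cE addrC subrK.
Qed.

(* A common root of f and g has multiplicity at least 3 in f^3 + g^3. *)
Lemma exact_double_root_cubes f g z q : (size f <= 3)%N -> (size g <= 3)%N ->
    f ^+ 3 + g ^+ 3 = ('X - z%:P) ^+ 2 * q -> q.[z] != 0 ->
  exists s c, s ^+ 3 = -1 /\ f = s%:P * g + c%:P * ('X - z%:P) ^+ 2.
Proof.
move=> szf szg fgE nz_qz; apply: (double_root_cubes szf szg fgE).
apply: contra_neq nz_qz => gz0.
have fz0 : f.[z] = 0.
  have := congr1 (horner^~ z) fgE; rewrite !hornerE /= gz0 subrr !expr0n /=.
  by rewrite mul0r addr0 => /eqP; rewrite expf_eq0 /= => /eqP.
have [r rE] := common_root_cubes fz0 gz0.
have /(mulfI (expf_neq0 2 (negbT (polyXsubC_eq0 z)))) -> :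
    ('X - z%:P) ^+ 2 * q = ('X - z%:P) ^+ 2 * (('X - z%:P) * r).
  by rewrite -fgE rE exprSr mulrA.
by rewrite !hornerE subrr mul0r.
Qed.

Lemma cube_root_N1_neq0 (s : K) : s ^+ 3 = -1 -> s != 0.
Proof.
by apply: contra_eq_neq => ->; rewrite expr0n /= eq_sym oppr_eq0 oner_eq0.
Qed.

Lemma double_root_scale_neq0 f g s c z : (forall c, f <> c *: g) ->
  f = s%:P * g + c%:P * ('X - z%:P) ^+ 2 -> c != 0.
Proof.
move=> nfg fE; apply: contra_notN (nfg s) => /eqP c0.
by rewrite fE c0 mul0r addr0 mul_polyC.
Qed.

(** If g(z) were nonzero, then f = s g + c u^2 with u = X - z and c nonzero. Since s^3 = -1 the g^3
    terms cancel, and f^3 + g^3 = u^2 (3 s^2 c g^2 + u (...)). The second factor is nonzero at z, so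
    the root would be exactly double. *)
Lemma triple_root_cubes f g z q : (size f <= 3)%N -> (size g <= 3)%N ->
    (forall c, f <> c *: g) ->
    f ^+ 3 + g ^+ 3 = ('X - z%:P) ^+ 3 * q -> f.[z] = 0 /\ g.[z] = 0.
Proof.
move=> szf szg nfg fgE.
suff gz0 : g.[z] = 0.
  split=> //; have := congr1 (horner^~ z) fgE.
  rewrite !hornerE /= gz0 subrr !expr0n /=.
  by rewrite mul0r addr0 => /eqP; rewrite expf_eq0 /= => /eqP.
apply/eqP/negPn/negP => nz_gz.
have [|s [c [s3 fE]]] := @double_root_cubes f g z (('X - z%:P) * q) szf szg _ nz_gz.
  by rewrite fgE exprSr mulrA.
have nz_s := cube_root_N1_neq0 s3.
have nz_c := double_root_scale_neq0 nfg fE.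
have := fgE; rewrite fE; set u := 'X - z%:P.
have -> : (s%:P * g + c%:P * u ^+ 2) ^+ 3 + g ^+ 3 =
    u ^+ 2 * ((3 * s ^+ 2 * c)%:P * g ^+ 2
       + u * (3%:P * s%:P * c%:P ^+ 2 * u * g + c%:P ^+ 3 * u ^+ 3)).
  have -> : g ^+ 3 = - (s ^+ 3)%:P * g ^+ 3 by rewrite s3 polyCN opprK mul1r.
  by ring.
rewrite [u ^+ 3 * _](_ : _ = u ^+ 2 * (u * q)); last by rewrite exprSr mulrA.
move/(mulfI (expf_neq0 2 (negbT (polyXsubC_eq0 z))))/(congr1 (horner^~ z)).
rewrite /u !hornerE subrr !mul0r addr0 => /eqP.
by rewrite !mulf_eq0 (negPf nz3) (negPf nz_s) (negPf nz_c) (negPf nz_gz).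
Qed.

(** * Cube of a quadratic, square of a cubic, and the sextic of A_{-1} *)

Lemma quadratic_two_roots h z w : (size h <= 3)%N -> z != w ->
  h.[z] = 0 -> h.[w] = 0 -> exists c, h = c *: (('X - z%:P) * ('X - w%:P)).
Proof.
move=> szh zw /rootP/factor_theorem[q hE].
rewrite hE !hornerE => /eqP; rewrite mulf_eq0 orbC subr_eq0 eq_sym (negPf zw) /=.
move=> /factor_theorem[r qE]; move: szh; rewrite hE qE -mulrA => szh.
exists r`_0; rewrite -mul_polyC -size1_polyC 1?[('X - z%:P) * _]mulrC //.
have [->|nz_r] := eqVneq r 0; first by rewrite size_poly0.
move: szh; rewrite size_Mmonic ?monicMl ?monicXsubC //.
by rewrite size_Mmonic ?polyXsubC_eq0 ?monicXsubC // !size_XsubC !addnS addn0 /= !ltnS.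
Qed.

Lemma cube_of_quadratic f g z w : (size f <= 3)%N -> (size g <= 3)%N ->
    (forall c, f <> c *: g) -> (forall c, g <> c *: f) -> z != w ->
  f ^+ 3 + g ^+ 3 <> (('X - z%:P) * ('X - w%:P)) ^+ 3.
Proof.
move=> szf szg nfg ngf zw E.
have [fz gz] := triple_root_cubes szf szg nfg (etrans E (exprMn 3 _ _)).
rewrite [('X - z%:P) * _]mulrC in E.
have [fw gw] := triple_root_cubes szf szg nfg (etrans E (exprMn 3 _ _)).
have [c fE] := quadratic_two_roots szf zw fz fw.
have [d gE] := quadratic_two_roots szg zw gz gw.
have [c0|nz_c] := eqVneq c 0.
  by apply: (nfg 0); rewrite fE c0 !scale0r.
by apply: (ngf (d / c)); rewrite gE fE scalerA divfK.
Qed.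

Lemma three_squares_free (a b c x y z : K) : (2 : K) != 0 ->
    x != y -> x != z ->
  a%:P * ('X - x%:P) ^+ 2 + b%:P * ('X - y%:P) ^+ 2
    + c%:P * ('X - z%:P) ^+ 2 = 0 -> a = 0.
Proof.
move=> nz2 xy xz E.
have := congr1 (fun p => p^`()^`().[0]) E.
have := congr1 (fun p => p^`().[0]) E; have := congr1 (horner^~ 0) E.
rewrite /= !derivE !hornerE /= => e0 e1 e2.
(* The value and the first two derivatives at 0 are, up to constants, the moments of the weights a,
   b, c at x, y, z. The combination below pairs the weights with 2 (T - y)(T - z), which vanishes at
   y and z and isolates a. *)
have : a * (2 * ((x - y) * (x - z))) = 0.
  have E0 u v w : u = 0 -> v = 0 -> w = 0 -> 2 * u + (y + z) * v + y * z * w = 0.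
    by move=> -> -> ->; rewrite !mulr0 !addr0.
  by rewrite -[RHS](E0 _ _ _ e0 e1 e2); ring.
move/eqP; rewrite !mulf_eq0 !subr_eq0 (negPf nz2) (negPf xy) (negPf xz).
by rewrite !orbF => /eqP.
Qed.

Lemma square_of_cubic f g x y z : (2 : K) != 0 ->
    (size f <= 3)%N -> (size g <= 3)%N -> (forall c, f <> c *: g) ->
    x != y -> x != z -> y != z ->
  f ^+ 3 + g ^+ 3 <> (('X - x%:P) * ('X - y%:P) * ('X - z%:P)) ^+ 2.
Proof.
move=> nz2 szf szg nfg xy xz yz fgE.
have root2 u v w : u != v -> u != w ->
    ('X - x%:P) * ('X - y%:P) * ('X - z%:P) =
    ('X - u%:P) * ('X - v%:P) * ('X - w%:P) ->
  exists s c, [/\ c != 0 & f = s%:P * g + c%:P * ('X - u%:P) ^+ 2].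
  move=> uv uw E; have [||s [c [_ fE]]] := @exact_double_root_cubes f g u
      ((('X - v%:P) * ('X - w%:P)) ^+ 2) szf szg.
  - by rewrite fgE E -exprMn mulrA.
  - by rewrite !hornerE !mulf_neq0 // subr_eq0.
  by exists s, c; split=> //; apply: double_root_scale_neq0 nfg fE.
have yx : y != x by rewrite eq_sym.
have zx : z != x by rewrite eq_sym.
have zy : z != y by rewrite eq_sym.
have [s1 [c1 [nz_c1 f1]]] := root2 x y z xy xz erefl.
have [|s2 [c2 [nz_c2 f2]]] := root2 y x z yx yz; first by ring.
have [|s3 [c3 [nz_c3 f3]]] := root2 z x y zx zy; first by ring.
have e1 : c1%:P * ('X - x%:P) ^+ 2 = f - s1%:P * g by rewrite f1 [RHS]addrC addKr.
have e2 : c2%:P * ('X - y%:P) ^+ 2 = f - s2%:P * g by rewrite f2 [RHS]addrC addKr.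
have e3 : c3%:P * ('X - z%:P) ^+ 2 = f - s3%:P * g by rewrite f3 [RHS]addrC addKr.
(* The three members f - s_i g of the pencil satisfy the relation with coefficients s2 - s3, s3 -
   s1, s1 - s2. Each is a multiple of a square, and such squares are independent. *)
have s23 : s2 = s3.
  have /eqP : (s2 - s3) * c1 = 0.
    apply: (@three_squares_free _ ((s3 - s1) * c2) ((s1 - s2) * c3) x y z) => //.
    by rewrite !polyCM -!mulrA e1 e2 e3; ring.
  by rewrite mulf_eq0 (negPf nz_c1) orbF subr_eq0 => /eqP.
(* Equal parameters mean the same member of the pencil, so c2 (X - y)^2 = c3 (X - z)^2, which fails
   at z. *)
move: f3; rewrite {1}f2 s23 => /addrI/(congr1 (horner^~ z)).
rewrite !hornerM !hornerC !hornerXsubC subrr !mulr0 => /eqP.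
by rewrite !mulf_eq0 (negPf nz_c2) subr_eq0 orbb (negPf zy).
Qed.

(* The product of the two cubes is determined by their sum, hence so is the
   unordered pair. *)
Lemma cubes_prod_A_minus1 f g (U := ('X - 1%:P) ^+ 2) (V := ('X - (-1)%:P) ^+ 2) :
    (2 : K) != 0 -> (size f <= 3)%N -> (size g <= 3)%N ->
    (forall c, f <> c *: g) ->
    f ^+ 3 + g ^+ 3 = U * V * ('X ^+ 2 + 1) ->
  108%:R * (f * g) ^+ 3 = (U ^+ 2 + U * V + V ^+ 2) ^+ 3.
Proof.
move=> nz2 szf szg nfg fgE.
have nz4 : (4 : K) != 0 by rewrite (natrM _ 2 2) mulf_neq0.
have U1 : U.[1] = 0 by rewrite hornerM hornerXsubC subrr mulr0.
have V1 : V.[1] = 4 by rewrite hornerM hornerXsubC; ring.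
have U_1 : U.[-1] = 4 by rewrite hornerM hornerXsubC; ring.
have V_1 : V.[-1] = 0 by rewrite hornerM hornerXsubC subrr mulr0.
have S1 : ('X ^+ 2 + 1 : {poly K}).[1] = 2 by rewrite !hornerE; ring.
have S_1 : ('X ^+ 2 + 1 : {poly K}).[-1] = 2 by rewrite !hornerE; ring.
have [||s [c [s3 fE]]] := @exact_double_root_cubes f g 1 (V * ('X ^+ 2 + 1)) szf szg.
- by rewrite fgE mulrA.
- by rewrite hornerM V1 S1 mulf_neq0.
have [||t [d [t3 fE']]] := @exact_double_root_cubes f g (-1) (U * ('X ^+ 2 + 1)) szf szg.
- by rewrite fgE [U * V]mulrC mulrA.
- by rewrite hornerM U_1 S_1 mulf_neq0.
have nz_c := double_root_scale_neq0 nfg fE.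
have nz_d := double_root_scale_neq0 nfg fE'.
rewrite -/U in fE; rewrite -/V in fE'.
have nzUV : U * V != 0 by rewrite mulf_neq0 // expf_neq0 // negbT ?polyXsubC_eq0.
(* From here on only the values of U and V at 1 and -1, and U V being nonzero, matter. *)
clearbody U V.
set w := t - s.
(* If t = s then c U = d V, and at 1, where U = 0 and V = 4, this forces d = 0. *)
have nz_w : w != 0.
  apply: contraNneq nz_d => /eqP; rewrite subr_eq0 => /eqP ts.
  have /addrI := etrans (esym fE) (etrans fE' (congr1 (fun s => s%:P * g + _) ts)).
  move/(congr1 (horner^~ 1)); rewrite !hornerM !hornerC U1 V1 mulr0 => /esym/eqP.
  by rewrite mulf_eq0 (negPf nz4) orbF.
(* The two expressions f = s g + c U = t g + d V are solved for g and f. *)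
have gw : w%:P * g = c%:P * U - d%:P * V.
  have -> : c%:P * U = f - s%:P * g by rewrite fE [RHS]addrC addKr.
  have -> : d%:P * V = f - t%:P * g by rewrite fE' [RHS]addrC addKr.
  by rewrite /w; ring.
have fw : w%:P * f = (t * c)%:P * U - (s * d)%:P * V.
  rewrite /w polyCB mulrBl {1}fE fE'; ring.
have ts0 : t ^+ 2 + t * s + s ^+ 2 = 0.
  apply: (mulfI nz_w); rewrite mulr0 -[RHS](subrr (-1)) -{1}t3 -s3 /w; ring.
have ts2 : t * s ^+ 2 + 1 = s ^+ 2 * w by rewrite -[1]opprK -s3 /w; ring.
have t2s : t ^+ 2 * s + 1 = - (t ^+ 2 * w) by rewrite -[1]opprK -t3 /w; ring.
have nz_s := cube_root_N1_neq0 s3.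
have nz_t := cube_root_N1_neq0 t3.
(* In w^3 (f^3 + g^3) the coefficients of U^3 and V^3 carry the factors t^3 + 1 and s^3 + 1, hence
   vanish. What remains is divisible by U V, which is cancelled. Evaluating the quotient at 1 and at
   -1 then yields two formulas for w^2. *)
have quotE : (w ^+ 3)%:P * ('X ^+ 2 + 1) =
    (3 * c * d)%:P * ((s ^+ 2 * w * d)%:P * V + (t ^+ 2 * w * c)%:P * U).
  apply: (mulfI nzUV); rewrite mulrCA -fgE.
  have -> : (w ^+ 3)%:P * (f ^+ 3 + g ^+ 3) = (w%:P * f) ^+ 3 + (w%:P * g) ^+ 3.
    by ring.
  rewrite fw gw -ts2 -[t ^+ 2 * w]opprK -t2s.
  have -> : ((t * c)%:P * U - (s * d)%:P * V) ^+ 3 + (c%:P * U - d%:P * V) ^+ 3 =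
      (t ^+ 3 + 1)%:P * (c%:P * U) ^+ 3 - (s ^+ 3 + 1)%:P * (d%:P * V) ^+ 3 +
      U * V * ((3 * c * d)%:P * (((t * s ^+ 2 + 1) * d)%:P * V +
        (- (t ^+ 2 * s + 1) * c)%:P * U)) by ring.
  by rewrite s3 t3 addNr !mul0r subr0 add0r.
have w2 : w ^+ 2 = 6 * c * d ^+ 2 * s ^+ 2.
  apply: (mulfI (mulf_neq0 nz_w nz2)); have := congr1 (horner^~ 1) quotE.
  rewrite hornerM hornerC S1 hornerM hornerD !hornerM !hornerC U1 V1 => E.
  by transitivity (w ^+ 3 * 2); [ring | rewrite E; ring].
have w2' : w ^+ 2 = 6 * c ^+ 2 * d * t ^+ 2.
  apply: (mulfI (mulf_neq0 nz_w nz2)); have := congr1 (horner^~ (-1)) quotE.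
  rewrite hornerM hornerC S_1 hornerM hornerD !hornerM !hornerC U_1 V_1 => E.
  by transitivity (w ^+ 3 * 2); [ring | rewrite E; ring].
have nz6 : (6 : K) != 0 by rewrite (natrM _ 2 3) mulf_neq0.
(* Comparing the two formulas for w^2 gives c t^2 = d s^2; multiply by t and use t^3 = -1. *)
have cE : c = - (d * s ^+ 2 * t).
  apply: (mulfI nz6); apply: (mulfI nz_c); apply: (mulfI nz_d).
  transitivity (- t ^+ 3 * (6 * c ^+ 2 * d)); first by rewrite t3; ring.
  transitivity (- t * (6 * c ^+ 2 * d * t ^+ 2)); first by ring.
  by rewrite -w2' w2; ring.
have wE : w ^+ 2 = - (3 * t * s).
  by rewrite -[RHS]addr0 -[in RHS]ts0 /w; ring.
have d3 : 2 * d ^+ 3 = -1.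
  apply: (mulfI nz3); apply: (mulfI nz_s); apply: (mulfI nz_t).
  transitivity (- s ^+ 3 * (6 * d ^+ 3 * t * s)); first by rewrite s3; ring.
  transitivity (6 * c * d ^+ 2 * s ^+ 2); first by rewrite cE; ring.
  by rewrite -w2 wE; ring.
have ts_1 : t ^+ 2 * s + t * s ^+ 2 = 1.
  by rewrite -[RHS](opprK 1) -s3 -[RHS]addr0 -(mulr0 s) -ts0; ring.
(* Expanding (w f)(w g), the coefficients of U^2, U V and V^2 all turn out to equal s d^2. *)
have fgw : (w ^+ 2)%:P * (f * g) = (s * d ^+ 2)%:P * (U ^+ 2 + U * V + V ^+ 2).
  transitivity ((w%:P * f) * (w%:P * g)); first by ring.
  have e1 : t * c ^+ 2 = s * d ^+ 2.
    transitivity (s ^+ 3 * t ^+ 3 * (s * d ^+ 2)); first by rewrite cE; ring.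
    by rewrite s3 t3; ring.
  have e2 : - (t + s) * c * d = s * d ^+ 2.
    transitivity ((t ^+ 2 * s + t * s ^+ 2) * (s * d ^+ 2)); first by rewrite cE; ring.
    by rewrite ts_1 mul1r.
  rewrite fw gw; transitivity ((t * c ^+ 2)%:P * U ^+ 2
      + (- (t + s) * c * d)%:P * (U * V) + (s * d ^+ 2)%:P * V ^+ 2); first by ring.
  by rewrite e1 e2; ring.
have w6 : (w ^+ 2) ^+ 3 = - 27%:R.
  by rewrite wE; transitivity (- 27%:R * (t ^+ 3 * s ^+ 3)); [ring | rewrite t3 s3; ring].
have d6 : 4 * (s * d ^+ 2) ^+ 3 = -1.
  transitivity (s ^+ 3 * (2 * d ^+ 3) ^+ 2); first by ring.
  by rewrite s3 d3; ring.
(* Cubing removes the choice of s, t, d: (w^2)^3 = -27 and 4 (s d^2)^3 = -1, whence 108 = 4 * 27. *)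
transitivity (- 4 * ((w ^+ 2)%:P * (f * g)) ^+ 3).
  by rewrite [in RHS]exprMn -polyC_exp w6; ring.
rewrite fgw; transitivity (- (4 * (s * d ^+ 2) ^+ 3)%:P
  * (U ^+ 2 + U * V + V ^+ 2) ^+ 3); first by ring.
by rewrite d6; ring.
Qed.

End SumOfTwoCubes.

(** * Passing from binary forms to univariate polynomials by y = 1 *)

Section Dehomogenization.
Variable K : fieldType.
Implicit Types f g : {mpoly K[2]}.

Definition dehomog f : {poly K} :=
  mmap (@polyC K) (fun i : 'I_2 => if i == 0 then 'X else 1) f.

Lemma dehomog_x : dehomog (varx K) = 'X.
Proof. by rewrite /dehomog mmapX mmap1U. Qed.

Lemma dehomog_y : dehomog (vary K) = 1.
Proof. by rewrite /dehomog mmapX mmap1U. Qed.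

Lemma dehomogZ c f : dehomog (c *: f) = c *: dehomog f.
Proof. by rewrite /dehomog mmapZ mul_polyC. Qed.

Lemma dehomogD f g : dehomog (f + g) = dehomog f + dehomog g.
Proof. exact: mmapD. Qed.

Lemma dehomogM f g : dehomog (f * g) = dehomog f * dehomog g.
Proof. exact: rmorphM. Qed.

Lemma dehomogX f n : dehomog (f ^+ n) = dehomog f ^+ n.
Proof. exact: rmorphXn. Qed.

Lemma dehomogE f : dehomog f = \sum_(m <- msupp f) f@_m *: 'X^(m 0).
Proof.
apply: eq_bigr => m _; rewrite mul_polyC /mmap1 !big_ord_recl big_ord0 /=.
by rewrite expr1n !mulr1.
Qed.

Lemma mdeg2 (m : 'X_{1..2}) : mdeg m = (m (0 : 'I_2)%R + m (1 : 'I_2)%R)%N.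
Proof.
rewrite mdegE !big_ord_recl big_ord0 addn0.
by congr (_ + m _)%N; apply: val_inj.
Qed.

(** In a fixed degree the exponent of x determines that of y, so no two monomials of f merge when y
    is set to 1. *)
Lemma coef_dehomog d f (m : 'X_{1..2}) : f \is d.-homog -> mdeg m = d ->
  (dehomog f)`_(m 0) = f@_m.
Proof.
move=> /dhomogP homf degm; rewrite dehomogE coef_sum [in RHS](mpolyE f) raddf_sum /=.
apply: eq_big_seq => m' /homf degm'; rewrite coefZ coefXn mcoeffZ mcoeffX.
congr (_ * _%:R); congr (nat_of_bool _); apply/eqP/eqP => [E|->//].
apply/mnmP => i; move: degm' degm; rewrite /= !mdeg2 E => <- /addnI e1.
by have [->|->] : i = 0 \/ i = 1
  by case: i => -[|[]] // ?; [left | right]; apply: val_inj.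
Qed.

Lemma size_dehomog d f : f \is d.-homog -> (size (dehomog f) <= d.+1)%N.
Proof.
move=> /dhomogP homf; rewrite dehomogE; apply: (leq_trans (size_sum _ _ _)).
apply/bigmax_leqP_seq => m /homf <- _; rewrite (leq_trans (size_scale_leq _ _)) //.
by rewrite size_polyXn ltnS /= mdeg2 leq_addr.
Qed.

Lemma dehomog_inj d f g : f \is d.-homog -> g \is d.-homog ->
  dehomog f = dehomog g -> f = g.
Proof.
move=> homf homg fg; apply/mpolyP => m.
have [degm|degm] := eqVneq (mdeg m) d.
  by rewrite -(coef_dehomog homf degm) fg (coef_dehomog homg degm).
by rewrite !(dhomog_nemf_coeff _ degm).
Qed.

End Dehomogenization.

Lemma dehomog_A (K : fieldType) (t : K) :
  dehomog (A t) = 'X ^+ 6 + t *: 'X ^+ 4 + t *: 'X ^+ 2 + 1.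
Proof.
rewrite /A !(dehomogD, dehomogZ, dehomogM, dehomogX) dehomog_x dehomog_y.
by rewrite !expr1n !mulr1.
Qed.

Lemma dehomog_B (K : fieldType) (t : K) :
  dehomog (B t) = 'X ^+ 6 + t *: 'X ^+ 3 + 1.
Proof.
rewrite /B !(dehomogD, dehomogZ, dehomogM, dehomogX) dehomog_x dehomog_y.
by rewrite !expr1n !mulr1.
Qed.

(** * Counting representations of the given sextics *)

Section Representations.
Variable K : fieldType.
Implicit Types f g p : {mpoly K[2]}.

Lemma dehomog_not_proportional f g : f \is 2.-homog -> g \is 2.-homog ->
  ~ proportional f g -> forall c, dehomog f <> c *: dehomog g.
Proof.
move=> homf homg nfg c; rewrite -dehomogZ => E; apply: nfg; left; exists c.
by apply: (dehomog_inj homf _ E); apply: dhomogZ.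
Qed.

Lemma proportionalC f g : proportional f g -> proportional g f.
Proof. by case; [right | left]. Qed.

(** Reduces vanishing of [N] to univariate polynomials: setting y = 1 respects sums and cubes, and
    it preserves non-proportionality because it is injective on quadratic forms. *)
Lemma N_eq0 p :
  (forall f g : {poly K}, (size f <= 3)%N -> (size g <= 3)%N ->
    (forall c, f <> c *: g) -> (forall c, g <> c *: f) ->
    f ^+ 3 + g ^+ 3 <> dehomog p) -> N p = 0%N%:E.
Proof.
move=> norep; rewrite /N; have -> : two_cube_reps p = set0.
  apply/seteqP; split=> // s [f [g [homf homg nfg pE _]]].
  apply: (norep (dehomog f) (dehomog g)).
  - exact: size_dehomog homf.
  - exact: size_dehomog homg.
  - exact: dehomog_not_proportional.
  - by apply: dehomog_not_proportional => // /proportionalC.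
  - by rewrite pE dehomogD !dehomogX.
by rewrite asboolT ?fset_set0 ?cardfs0.
Qed.

Lemma N_eq1 p s : two_cube_reps p = [set s]%classic -> N p = 1%N%:E.
Proof. by rewrite /N => ->; rewrite asboolT // fset_set1 cardfs1. Qed.

(** Here z plays the role of i: A_3 becomes (X^2 + 1)^3 = ((X - z)(X + z))^3. *)
Lemma N_A_3 (z : K) : (2 : K) != 0 -> (3 : K) != 0 -> z ^+ 2 = -1 ->
  N (A (3 : K)) = 0%N%:E.
Proof.
move=> nz2 nz3 z2; apply: N_eq0 => f g szf szg nfg ngf; rewrite dehomog_A.
have zNz : z != - z.
  rewrite -subr_eq0 opprK -mulr2n -mulr_natl mulf_neq0 //.
  by apply: contra_eq_neq z2 => ->; rewrite expr0n /= eq_sym oppr_eq0 oner_eq0.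
have := cube_of_quadratic nz3 szf szg nfg ngf zNz; apply: contra_not => ->.
have -> : ('X - z%:P) * ('X - (- z)%:P) = 'X ^+ 2 - (z ^+ 2)%:P by ring.
by rewrite z2 -!mul_polyC; ring.
Qed.

(** The sign e treats B_2 and B_{-2} at once: B_{2e} becomes (X^3 + e)^2, and the cubic has the
    distinct roots -e, -e w, -e w^2 for w a primitive cube root of unity. *)
Lemma N_B_square (w e : K) : (2 : K) != 0 -> (3 : K) != 0 ->
  w ^+ 2 + w + 1 = 0 -> e ^+ 2 = 1 -> N (B (2 * e)) = 0%N%:E.
Proof.
move=> nz2 nz3 w2 e2; apply: N_eq0 => f g szf szg nfg _; rewrite dehomog_B.
have nz_e : e != 0.
  by apply: contra_eq_neq e2 => ->; rewrite expr0n /= eq_sym oner_eq0.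
have w1 : w != 1.
  by apply: contra_eq_neq w2 => ->; have -> : 1 ^+ 2 + 1 + 1 = 3 :> K by ring.
have nz_w : w != 0.
  by apply: contra_eq_neq w2 => ->; rewrite expr0n /= !add0r oner_eq0.
have w3 : w ^+ 3 = 1.
  apply/eqP; rewrite -subr_eq0; apply/eqP.
  by transitivity ((w - 1) * (w ^+ 2 + w + 1)); [ring | rewrite w2 mulr0].
have xy : - e != - (e * w).
  by rewrite eqr_opp -[X in X == _]mulr1 (inj_eq (mulfI nz_e)) eq_sym.
have yz : - (e * w) != - (e * w ^+ 2).
  rewrite eqr_opp (inj_eq (mulfI nz_e)) -[X in X == _]mulr1 expr2.
  by rewrite (inj_eq (mulfI nz_w)) eq_sym.
have xz : - e != - (e * w ^+ 2).
  rewrite eqr_opp -[X in X == _]mulr1 (inj_eq (mulfI nz_e)).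
  by apply: contra_neq w1 => w21; rewrite -w3 exprS -w21 mulr1.
have := square_of_cubic nz3 nz2 szf szg nfg xy xz yz; apply: contra_not => ->.
have -> : ('X - (- e)%:P) * ('X - (- (e * w))%:P) * ('X - (- (e * w ^+ 2))%:P) =
    'X ^+ 3 + (e * (w ^+ 2 + w + 1))%:P * 'X ^+ 2
    + (e ^+ 2 * w * (w ^+ 2 + w + 1))%:P * 'X + (e * e ^+ 2 * w ^+ 3)%:P by ring.
rewrite w2 w3 e2 !mulr0 !mul0r !mulr1 !addr0 -mul_polyC.
transitivity ('X ^+ 6 + (2 * e)%:P * 'X ^+ 3 + (e ^+ 2)%:P); last by ring.
by rewrite e2.
Qed.

(** Changing the sign of b amounts to y -> -y, so the cubes for b and -b add up to a form even in y,
    as A_{-1} is. *)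
Definition split_form (a b : K) : {mpoly K[2]} :=
  a *: (varx K ^+ 2 + vary K ^+ 2) + b *: (varx K * vary K).

Lemma dehomog_split_form a b :
  dehomog (split_form a b) = a *: ('X ^+ 2 + 1) + b *: 'X.
Proof.
rewrite !(dehomogD, dehomogZ, dehomogM, dehomogX) dehomog_x dehomog_y.
by rewrite expr1n mulr1.
Qed.

Lemma split_form_homog a b : split_form a b \is 2.-homog.
Proof.
have homX i : 'X_i \is [in K[2], 1.-homog] by rewrite dhomogX /= mdeg1.
apply: dhomogD; apply: dhomogZ; last exact: (dhomogM (homX _) (homX _)).
by apply: dhomogD; exact: (dhomogMn 2 (homX _)).
Qed.

(** The sum is 2 a^3 (x^2 + y^2)^3 + 6 a b^2 (x^2 + y^2) x^2 y^2, and the two conditions make it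
    (x^2 + y^2)((x^2 + y^2)^2 - 4 x^2 y^2) = (x^2 + y^2)(x^2 - y^2)^2. *)
Lemma split_form_cubes a b : 2 * a ^+ 3 = 1 -> 3 * a * b ^+ 2 = -2 ->
  A (-1) = split_form a b ^+ 3 + split_form a (- b) ^+ 3.
Proof.
move=> a3 ab2; rewrite /split_form.
transitivity ((2 * a ^+ 3)%:MP * (varx K ^+ 2 + vary K ^+ 2) ^+ 3
  + (2 * (3 * a * b ^+ 2))%:MP * (varx K ^+ 2 + vary K ^+ 2)
      * varx K ^+ 2 * vary K ^+ 2); last by rewrite -!mul_mpolyC; ring.
by rewrite a3 ab2 /A -!mul_mpolyC; ring.
Qed.

Lemma N_A_minus1 (a b : K) : (2 : K) != 0 -> (3 : K) != 0 ->
  2 * a ^+ 3 = 1 -> 3 * a * b ^+ 2 = -2 -> N (A (-1 : K)) = 1%N%:E.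
Proof.
move=> nz2 nz3 a3 ab2; set f0 := split_form a b; set g0 := split_form a (- b).
have hom3 f : f \is 2.-homog -> f ^+ 3 \is 6.-homog by move/(dhomogMn 3).
have homf0 : f0 \is 2.-homog := split_form_homog _ _.
have homg0 : g0 \is 2.-homog := split_form_homog _ _.
have nz_a : a != 0.
  by apply: contra_eq_neq a3 => ->; rewrite expr0n /= mulr0 eq_sym oner_eq0.
have nz_b : b != 0.
  apply: contra_eq_neq ab2 => ->.
  by rewrite expr0n /= mulr0 eq_sym oppr_eq0.
have nprop u v : u != 0 -> v != 0 ->
    forall c, split_form u v <> c *: split_form u (- v).
  move=> nz_u nz_v c /(congr1 (@dehomog K)); rewrite dehomogZ !dehomog_split_form => E.
  (* The constant coefficient forces c = 1, and then the coefficient of X forces v = -v. *)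
  have := congr1 (fun p : {poly K} => p`_0) E; have := congr1 (fun p : {poly K} => p`_1) E.
  rewrite /= !coefE /= !(addr0, add0r, mulr0, mulr1).
  move=> vE /esym/eqP; rewrite -{2}[u]mul1r (inj_eq (mulIf nz_u)) => /eqP c1.
  move: vE; rewrite c1 mul1r => /eqP; rewrite -subr_eq0 opprK -mulr2n -mulr_natl.
  by rewrite mulf_eq0 (negPf nz2) (negPf nz_v).
have nfg0 : ~ proportional f0 g0.
  case=> -[c]; first exact: nprop.
  by rewrite /f0 -[b]opprK; apply: nprop; rewrite ?oppr_eq0.
have fg0 : A (-1) = f0 ^+ 3 + g0 ^+ 3 by exact: split_form_cubes.
pose U : {poly K} := ('X - 1%:P) ^+ 2; pose V : {poly K} := ('X - (-1)%:P) ^+ 2.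
have prodE f g : f \is 2.-homog -> g \is 2.-homog -> ~ proportional f g ->
    A (-1) = f ^+ 3 + g ^+ 3 ->
  108%:R * (dehomog f * dehomog g) ^+ 3 = (U ^+ 2 + U * V + V ^+ 2) ^+ 3.
  move=> homf homg nfg pE; apply: cubes_prod_A_minus1 => //.
  - exact: size_dehomog homf.
  - exact: size_dehomog homg.
  - exact: dehomog_not_proportional.
  - rewrite -!dehomogX -dehomogD -pE dehomog_A -!mul_polyC; ring.
have nz108 : 108%:R != 0 :> {poly K}.
  rewrite -polyC_natr polyC_eq0 (natrM _ 4 27) (natrM _ 2 2) (natrX _ 3 3).
  by rewrite !mulf_neq0 ?expf_neq0.
apply: (@N_eq1 _ [fset f0 ^+ 3; g0 ^+ 3]%fset); apply/seteqP; split; last first.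
  by move=> _ ->; exists f0, g0.
move=> _ [f [g [homf homg nfg pE ->]]].
have := etrans (prodE _ _ homf homg nfg pE) (esym (prodE _ _ homf0 homg0 nfg0 fg0)).
move/(mulfI nz108); rewrite !exprMn -!dehomogX => prod_eq.
have sum_eq := etrans (esym pE) fg0.
(* Both pairs of cubes have the same sum and product, so f^3 is a root of (T - f0^3)(T - g0^3). The
   argument takes place in the integral domain of univariate polynomials and returns to sextic forms
   by injectivity. *)
have /eqP : (dehomog (f ^+ 3) - dehomog (f0 ^+ 3)) * (dehomog (f ^+ 3) - dehomog (g0 ^+ 3)) = 0.
  transitivity (dehomog (f ^+ 3) * (dehomog (f ^+ 3 + g ^+ 3) - dehomog (f0 ^+ 3 + g0 ^+ 3))
    - (dehomog (f ^+ 3) * dehomog (g ^+ 3) - dehomog (f0 ^+ 3) * dehomog (g0 ^+ 3))).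
    by rewrite !dehomogD; ring.
  by rewrite prod_eq sum_eq !subrr mulr0 subr0.
rewrite mulf_eq0 !subr_eq0 => /orP[] /eqP/(dehomog_inj (hom3 _ homf)).
  move=> /(_ (hom3 _ homf0)) fE.
  by move: sum_eq; rewrite fE => /addrI ->.
move=> /(_ (hom3 _ homg0)) fE.
by move: sum_eq; rewrite fE [RHS]addrC => /addrI ->; rewrite /= fsetUC.
Qed.

End Representations.

Theorem theorem5p8 (R : realType) :
  [/\ N (A (3 : R[i])) = 0%N%:E,
      N (B (2 : R[i])) = 0%N%:E /\ N (B (- 2 : R[i])) = 0%N%:E
    & N (A (- 1 : R[i])) = 1%N%:E].
Proof.
have nz2 : (2 : R[i]) != 0 by rewrite pnatr_eq0.
have nz3 : (3 : R[i]) != 0 by rewrite pnatr_eq0.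
(* A primitive cube root of unity. *)
pose w : R[i] := (sqrtC (- 3) - 1) / 2.
have w2 : w ^+ 2 + w + 1 = 0.
  transitivity ((sqrtC (- 3) ^+ 2 + 3) / 4 : R[i]); first by rewrite /w; field.
  by rewrite sqrtCK addNr mul0r.
pose a : R[i] := 3.-root (2^-1).
have a3 : 2 * a ^+ 3 = 1 by rewrite rootCK // divff.
have nz_a : a != 0.
  by apply: contra_eq_neq a3 => ->; rewrite expr0n /= mulr0 eq_sym oner_eq0.
split.
- exact: (N_A_3 nz2 nz3 (sqrCi _)).
- split; first by rewrite -[2]mulr1; apply: (N_B_square nz2 nz3 w2 (expr1n _ 2)).
  by rewrite -[2]mulr1 -mulrN; apply: (N_B_square nz2 nz3 w2 (etrans (sqrrN 1) (expr1n _ 2))).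
(* With a a cube root of 1/2, the second parameter solves 3 a b^2 = -2. *)
apply: (@N_A_minus1 _ a (sqrtC (- 2 / (3 * a)))) => //.
by rewrite sqrtCK; field.
Qed.
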